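(* For any countable set $T$ of formulas of $\mathcal{L}_\square$ and any formula $\varphi\in\mathcal{L}_\square$, the following are equivalent: (i) $T\vdash_{\mathcal{G}_\square}\varphi$; (ii) $T\models_{GK\le}\varphi$; (iii) $T\models_{GK}\varphi$; (iv) $T\models_{Crisp}\varphi$.
   Context: $\mathcal{L}_\square$ is the set of formulas built from a set $Var$ of propositional variables using $\wedge,\to,\bot,\square$, with $\neg\varphi:=\varphi\to\bot$, $\varphi\vee\psi:=((\varphi\to\psi)\to\psi)\wedge((\psi\to\varphi)\to\varphi)$, $\varphi\leftrightarrow\psi:=(\varphi\to\psi)\wedge(\psi\to\varphi)$. The Gödel calculus $\mathcal{G}$ has axiom schemes $(\varphi\to\psi)\to((\psi\to\chi)\to(\varphi\to\chi))$; $(\varphi\wedge\psi)\to\varphi$; $(\varphi\wedge\psi)\to(\psi\wedge\varphi)$; $(\varphi\to(\psi\to\chi))\leftrightarrow((\varphi\wedge\psi)\to\chi)$; $\varphi\to(\varphi\wedge\varphi)$; $((\varphi\to\psi)\to\chi)\to(((\psi\to\varphi)\to\chi)\to\chi)$; $\bot\to\varphi$; and Modus Ponens. $\mathcal{G}_\square$ adds the schemes $\square(\varphi\to\psi)\to(\square\varphi\to\square\psi)$ and $\neg\neg\square\theta\to\square\neg\neg\theta$ and the rule ''from $\varphi$ infer $\square\varphi$''; $T\vdash_{\mathcal{G}_\square}\varphi$ means derivability from assumptions $T$, with the $\square$-rule applied only to theorems (steps not depending on assumptions). Semantics: on $[0,1]$, $a\cdot b=\min\{a,b\}$, $a\Rightarrow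 b=1$ if $a\le b$ and $=b$ otherwise. A GK-model $\langle W,S,e\rangle$ has a nonempty set $W$, $S:W\times W\to[0,1]$, $e:W\times Var\to[0,1]$, extended by $e(x,\varphi\wedge\psi)=e(x,\varphi)\cdot e(x,\psi)$, $e(x,\varphi\to\psi)=e(x,\varphi)\Rightarrow e(x,\psi)$, $e(x,\bot)=0$, $e(x,\square\varphi)=\inf_{y\in W}\{Sxy\Rightarrow e(y,\varphi)\}$. It is crisp if $S$ takes only the values $0,1$. $T\models_{GK}\varphi$: for every GK-model and world $x$, if $e(x,\psi)=1$ for all $\psi\in T$ then $e(x,\varphi)=1$; $T\models_{Crisp}\varphi$: the same, but only over crisp GK-models; $T\models_{GK\le}\varphi$: for every GK-model and world $x$, $\inf\{e(x,\psi):\psi\in T\}\le e(x,\varphi)$. *)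

(* Defs.v *)
From mathcomp Require Import all_boot all_order all_algebra.
From mathcomp Require Import all_classical all_reals.

Set Implicit Arguments.
Unset Strict Implicit.
Unset Printing Implicit Defensive.

Import Order.TTheory GRing.Theory Num.Theory.

Local Open Scope classical_set_scope.
Local Open Scope ring_scope.

Inductive formula (Var : Type) : Type :=
| FVar of Var
| FBot
| FAnd of formula Var & formula Var
| FImp of formula Var & formula Var
| FBox of formula Var.

Arguments FBot {Var}.

Declare Scope gml_scope.
Delimit Scope gml_scope with gml.
Bind Scope gml_scope with formula.

Notation "A ∧ B" := (FAnd A B)
  (at level 80, right associativity) : gml_scope.
Notation "A → B" := (FImp A B)
  (at level 99, B at level 200, right associativity) : gml_scope.
Notation "□ A" := (FBox A) (at level 75, right associativity) : gml_scope.

Definition FNeg (Var : Type) (A : formula Var) : formula Var :=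
  (A → FBot)%gml.
Definition FIff (Var : Type) (A B : formula Var) : formula Var :=
  ((A → B) ∧ (B → A))%gml.
Definition FOr (Var : Type) (A B : formula Var) : formula Var :=
  (((A → B) → B) ∧ ((B → A) → A))%gml.

Notation "¬ A" := (FNeg A) (at level 75, right associativity) : gml_scope.
Notation "A ↔ B" := (FIff A B) (at level 95, no associativity) : gml_scope.
Notation "A ∨ B" := (FOr A B) (at level 85, right associativity) : gml_scope.

Inductive godel_axiom (Var : Type) : formula Var -> Prop :=
| GAx_trans A B C : godel_axiom ((A → B) → ((B → C) → (A → C)))%gml
| GAx_andl A B : godel_axiom ((A ∧ B) → A)%gml
| GAx_andC A B : godel_axiom ((A ∧ B) → (B ∧ A))%gml
| GAx_curry A B C : godel_axiom ((A → (B → C)) ↔ ((A ∧ B) → C))%gml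
| GAx_and_idem A : godel_axiom (A → (A ∧ A))%gml
| GAx_prelin A B C :
    godel_axiom (((A → B) → C) → (((B → A) → C) → C))%gml
| GAx_exfalso A : godel_axiom (FBot → A)%gml.

Inductive box_axiom (Var : Type) : formula Var -> Prop :=
| BAx_K A B : box_axiom (□ (A → B) → (□ A → □ B))%gml
| BAx_Z A : box_axiom (¬ ¬ □ A → □ ¬ ¬ A)%gml.

(* Derivability from assumptions.  The premise of the necessitation rule is a
   derivation from the empty set of assumptions, i.e. the rule is applied to
   theorems only. *)
Inductive derives (Var : Type) (T : set (formula Var)) :
    formula Var -> Prop :=
| Der_assum A : T A -> derives T A
| Der_godel A : godel_axiom A -> derives T A
| Der_box A : box_axiom A -> derives T A
| Der_mp A B : derives T (A → B)%gml -> derives T A -> derives T B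
| Der_nec A : derives set0 A -> derives T (□ A)%gml.

Definition godel_imp (R : realType) (a b : R) : R := if a <= b then 1 else b.

Record GKmodel (R : realType) (Var : Type) : Type := MkGKmodel {
  world : Type;
  world_inhabited : inhabited world;
  acc : world -> world -> R;
  acc01 : forall x y, 0 <= acc x y <= 1;
  atom_val : world -> Var -> R;
  atom_val01 : forall x p, 0 <= atom_val x p <= 1 }.

Fixpoint value (R : realType) (Var : Type) (M : GKmodel R Var)
    (A : formula Var) (x : world M) {struct A} : R :=
  match A with
  | FVar p => atom_val x p
  | FBot => 0
  | FAnd B C => Num.min (value B x) (value C x)
  | FImp B C => godel_imp (value B x) (value C x)
  | FBox B => inf [set godel_imp (acc x y) (value B y) | y in [set: world M]]
  end.

Definition crisp (R : realType) (Var : Type) (M : GKmodel R Var) : Prop :=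
  forall x y : world M, acc x y = 0 \/ acc x y = 1.

(* Infimum in the complete lattice [0,1].  Adding the top element 1 changes
   nothing for nonempty E and gives the value 1 for E = set0, whereas the real
   [inf set0] is 0. *)
Definition inf01 (R : realType) (E : set R) : R := inf (E `|` [set 1]).

Definition GK_le_consequence (R : realType) (Var : Type)
    (T : set (formula Var)) (A : formula Var) : Prop :=
  forall (M : GKmodel R Var) (x : world M),
    inf01 [set value B x | B in T] <= value A x.

Definition GK_consequence (R : realType) (Var : Type)
    (T : set (formula Var)) (A : formula Var) : Prop :=
  forall (M : GKmodel R Var) (x : world M),
    (forall B, T B -> value B x = 1) -> value A x = 1.

Definition crisp_consequence (R : realType) (Var : Type)
    (T : set (formula Var)) (A : formula Var) : Prop :=
  forall M : GKmodel R Var, crisp M -> forall x : world M,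
    (forall B, T B -> value B x = 1) -> value A x = 1.

(* Main.v *)
Require Import Defs.
From mathcomp Require Import all_boot all_order all_algebra.
From mathcomp Require Import all_classical all_reals.
From mathcomp Require Import lra.

(* Soundness is an induction on derivations. For completeness, let [T] not
   derive [phi]; renaming the countably many variables involved, we may assume
   that the variables are natural numbers. Extending [T] to a maximal theory not
   deriving [phi], prelinearity turns provable implication into a countable
   linear preorder, which embeds into [0,1]; so every underivability is
   witnessed by a Gödel valuation of all formulas (boxed formulas being treated
   as atoms) that validates the theorems of the logic. These valuations are the
   worlds of a crisp canonical model, with [S v w] iff [v (□ B) <= w B] for all
   [B]. If [a := v (□ A) < 1], the formulas [B] with [a < v (□ B)] do not
   derive [A], so some valuation [u] has [u B = 1] on them and [u A < 1].
   Squeezing the open interval (0,1) increasingly into (a, a + e) makes [u] an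
   [S]-successor of [v] with value at most [a + e] at [A]; axiom Z guarantees
   that [u B = 0] only when [v (□ B) = 0]. *)

Set Implicit Arguments.
Unset Strict Implicit.
Unset Printing Implicit Defensive.

Import Order.TTheory GRing.Theory Num.Theory.

Local Open Scope classical_set_scope.
Local Open Scope ring_scope.

(** * Derived rules, the deduction theorem and linear theories *)

Section Calculus.
Variable Var : Type.
Implicit Types (A B C X : formula Var) (T U : set (formula Var)).

Lemma derives_mono T U A : T `<=` U -> derives T A -> derives U A.
Proof.
move=> + D; elim: D U =>
  [{}T {}A TA|{}T {}A ax|{}T {}A ax|{}T {}A B _ IH1 _ IH2|{}T {}A D _]
   U TU; [exact/Der_assum/TU|exact: Der_godel|exact: Der_box| |exact: Der_nec].
by apply: Der_mp (IH1 _ TU) (IH2 _ TU).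
Qed.

Lemma derives_thm T A : derives set0 A -> derives T A.
Proof. by apply: derives_mono => //; exact: sub0set. Qed.

Lemma derives_trans T A B C :
  derives T (A → B)%gml -> derives T (B → C)%gml -> derives T (A → C)%gml.
Proof.
by move=> AB BC; apply: Der_mp BC; apply: Der_mp AB; exact/Der_godel/GAx_trans.
Qed.

Lemma derives_andl T A B : derives T (A ∧ B → A)%gml.
Proof. exact/Der_godel/GAx_andl. Qed.

Lemma derives_andC T A B : derives T (A ∧ B → B ∧ A)%gml.
Proof. exact/Der_godel/GAx_andC. Qed.

Lemma derives_andr T A B : derives T (A ∧ B → B)%gml.
Proof. exact: derives_trans (derives_andC _ _ _) (derives_andl _ _ _). Qed.

Lemma derives_refl T A : derives T (A → A)%gml.
Proof.
by apply: derives_trans (derives_andl _ A A); exact/Der_godel/GAx_and_idem.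
Qed.

Lemma derives_uncurry T A B C :
  derives T (A → B → C)%gml -> derives T (A ∧ B → C)%gml.
Proof.
apply: Der_mp; apply: Der_mp (derives_andl _ _ _) _.
exact/Der_godel/GAx_curry.
Qed.

Lemma derives_curry T A B C :
  derives T (A ∧ B → C)%gml -> derives T (A → B → C)%gml.
Proof.
apply: Der_mp; apply: Der_mp (derives_andr _ _ _) _.
exact/Der_godel/GAx_curry.
Qed.

Lemma derives_weaken T A B : derives T (A → B → A)%gml.
Proof. exact/derives_curry/derives_andl. Qed.

Lemma derives_pair T X A B :
  derives T (X → A)%gml -> derives T (X → B)%gml -> derives T (X → A ∧ B)%gml.
Proof.
move=> XA XB.
have XBAB : derives T (X → B → A ∧ B)%gml.
  by apply: derives_trans XA _; apply/derives_curry/derives_refl.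
have BXAB : derives T (B → X → A ∧ B)%gml.
  apply: derives_curry; apply: derives_trans (derives_andC _ _ _) _.
  exact: derives_uncurry.
apply: (@derives_trans _ _ (X ∧ X)%gml); first exact/Der_godel/GAx_and_idem.
by apply: derives_uncurry; apply: derives_trans BXAB.
Qed.

Lemma derives_app T X A B :
  derives T (X → A → B)%gml -> derives T (X → A)%gml -> derives T (X → B)%gml.
Proof.
move=> XAB XA; apply: derives_trans (derives_uncurry XAB).
by apply: derives_pair XA; exact: derives_refl.
Qed.

(** Necessitation is harmless here: its premise is a theorem, so [□ A] is derivable from [T] alone
    and can be weakened by [X]. *)
Lemma deduction T X A : derives (T `|` [set X]) A -> derives T (X → A)%gml.
Proof.
move UE: (T `|` [set X]) => U D.
have thm B : derives T B -> derives T (X → B)%gml.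
  by apply: Der_mp; exact: derives_weaken.
elim: D UE => [{}U {}A UA|{}U {}A ax|{}U {}A ax|{}U {}A B _ IH1 _ IH2|
  {}U {}A D _] UE.
- move: UA; rewrite -UE => -[TA|->]; first exact/thm/Der_assum.
  exact: derives_refl.
- exact/thm/Der_godel.
- exact/thm/Der_box.
- by apply: derives_app (IH1 UE) (IH2 UE).
- exact/thm/Der_nec.
Qed.

(** A derivation uses finitely many assumptions, and in a chain the finitely many members involved
    lie in the largest of them. The first alternative covers the empty chain. *)
Lemma derives_bigcup_chain T (F : set (set (formula Var))) A :
  total_on F subset -> derives (T `|` \bigcup_(X in F) X) A ->
  derives T A \/ exists2 X, F X & derives (T `|` X) A.
Proof.
move=> totF.
move UE: (T `|` \bigcup_(X in F) X) => U D.
have weak (Y : set (formula Var)) B : derives T B -> derives (T `|` Y) B.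
  by apply: derives_mono; left.
elim: D UE => [{}U {}A UA|{}U {}A ax|{}U {}A ax|{}U {}A B _ IH1 _ IH2|
  {}U {}A D _] UE.
- move: UA; rewrite -UE => -[TA|[X FX XA]]; first by left; apply: Der_assum.
  by right; exists X => //; apply: Der_assum; right.
- by left; apply: Der_godel.
- by left; apply: Der_box.
- have [D1|[X FX D1]] := IH1 UE; have [D2|[Y FY D2]] := IH2 UE.
  + by left; apply: Der_mp D1 D2.
  + by right; exists Y => //; apply: Der_mp D2; apply: weak.
  + by right; exists X => //; apply: Der_mp D1 _; apply: weak.
  + have [XY|YX] := totF _ _ FX FY; right.
    * exists Y => //; apply: Der_mp D2; apply: derives_mono D1.
      exact: setUS.
    * exists X => //; apply: (Der_mp D1); apply: derives_mono D2.
      exact: setUS.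
- by left; apply: Der_nec.
Qed.

Lemma linear_extension T X : ~ derives T X ->
  exists U, [/\ T `<=` U, ~ derives U X &
    forall A B, derives U (A → B)%gml \/ derives U (B → A)%gml].
Proof.
move=> TX.
(* Zorn is applied to the sets added to [T], so that the empty chain, with empty union, is
   admissible. *)
have [|U [UX maxU]] := @Zorn_bigcup _ [set U | ~ derives (T `|` U) X].
  move=> F FX totF /(derives_bigcup_chain totF)[//|[Y FY]].
  exact: FX.
exists (T `|` U); split=> // A B.
(* By maximality, adding an underivable [C] makes [X] derivable. If this applies to both
   implications, prelinearity yields [X]. *)
have maxD C : ~ derives (T `|` U) C -> derives (T `|` U) (C → X)%gml.
  move=> nC; apply: deduction; apply: contrapT => nX.
  apply: (maxU (U `|` [set C])); last by rewrite /= setUA.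
  split=> [|sub]; first by left.
  by apply: nC; apply: Der_assum; right; apply: sub; right.
have [|/maxD AX] := pselect (derives (T `|` U) (A → B)%gml); first by left.
have [|/maxD BX] := pselect (derives (T `|` U) (B → A)%gml); first by right.
exfalso; apply: UX; apply: Der_mp BX; apply: Der_mp AX.
exact/Der_godel/GAx_prelin.
Qed.

End Calculus.

(** * Substitution *)

Fixpoint subst (V W : Type) (s : V -> formula W) (A : formula V) : formula W :=
  match A with
  | FVar p => s p
  | FBot => FBot
  | FAnd B C => FAnd (subst s B) (subst s C)
  | FImp B C => FImp (subst s B) (subst s C)
  | FBox B => FBox (subst s B)
  end.

Lemma derives_subst (V W : Type) (s : V -> formula W) T A :
  derives T A -> derives (subst s @` T) (subst s A).
Proof.
elim=> [{}T {}A TA|{}T {}A|{}T {}A|{}T {}A B _ IH1 _ IH2|{}T {}A _ IH].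
- by apply: Der_assum; exists A.
- by case=> *; apply: Der_godel; constructor.
- by case=> *; apply: Der_box; constructor.
- exact: Der_mp IH1 IH2.
- by apply: Der_nec; rewrite image_set0 in IH.
Qed.

(** * Soundness over all models *)

Section Soundness.
Variable R : realType.
Implicit Types a b c : R.

Lemma godel_imp01 a b : 0 <= b <= 1 -> 0 <= godel_imp a b <= 1.
Proof. by rewrite /godel_imp; case: ifP => // _ _; rewrite ler01 lexx. Qed.

(** Residuation of [min] and Gödel implication; the bound on [c] reflects that implication never
    exceeds 1. *)
Lemma godel_impP a b c : c <= 1 -> (c <= godel_imp a b) = (Num.min c a <= b).
Proof.
move=> c1; rewrite /godel_imp ge_min.
by case: (leP a b) => ab; rewrite ?orbT // orbF.
Qed.

Lemma godel_imp1 a b : a <= b -> godel_imp a b = 1.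
Proof. by rewrite /godel_imp => ->. Qed.

Lemma godel_imp_eq1 a b : a <= 1 -> godel_imp a b = 1 -> a <= b.
Proof. by move=> a1; rewrite /godel_imp; case: ifP => // + b1; rewrite b1 a1. Qed.

Lemma godel_impE a b : b < a -> godel_imp a b = b.
Proof. by move=> ba; rewrite /godel_imp leNgt ba. Qed.

Lemma godel_1imp a : a <= 1 -> godel_imp 1 a = a.
Proof.
move=> a1; rewrite /godel_imp; case: leP => // a1'; apply/eqP.
by rewrite eq_le a1' a1.
Qed.

Lemma godel_imp_mp a b c : c <= godel_imp a b -> c <= a -> c <= b.
Proof.
by rewrite /godel_imp; case: ifP => // ab _ ca; exact: le_trans ca ab.
Qed.

Section Model.
Variables (Var : Type) (M : GKmodel R Var).
Implicit Types (A B C : formula Var) (x y : world M).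

Lemma box_value_ge A x (c : R) :
  (forall y, c <= godel_imp (acc x y) (value A y)) -> c <= value (FBox A) x.
Proof.
move=> le_c; apply: lb_le_inf => [|_ [y _ <-]]; last exact: le_c.
by exists (godel_imp (acc x x) (value A x)), x.
Qed.

Lemma value01 A x : 0 <= value A x <= 1.
Proof.
elim: A x => [p||B IHB C IHC|B _ C IHC|B IHB] x.
- exact: atom_val01.
- by rewrite lexx ler01.
- by rewrite /=; case: (leP (value B x) (value C x)) => _.
- exact/godel_imp01.
- apply/andP; split.
    by apply: box_value_ge => y; case/andP: (godel_imp01 (acc x y) (IHB y)).
  have [_ le1] := andP (godel_imp01 (acc x x) (IHB x)).
  apply: le_trans le1; apply: ge_inf; last by exists x.
  by exists 0 => _ [y _ <-]; case/andP: (godel_imp01 (acc x y) (IHB y)).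
Qed.

Lemma box_value_le A x y :
  value (FBox A) x <= godel_imp (acc x y) (value A y).
Proof.
apply: ge_inf; last by exists y.
by exists 0 => _ [z _ <-]; case/andP: (godel_imp01 (acc x z) (value01 A z)).
Qed.

Lemma godel_axiom_sound A x : godel_axiom A -> value A x = 1.
Proof.
case=> {A} [A B C|A B|A B|A B C|A|A B C|A] /=; have := value01 A x;
  try have := value01 B x; try have := value01 C x;
  move: (value A x) => a; try (move: (value B x) => b);
  try (move: (value C x) => c).
- move=> c01 b01 a01; apply: godel_imp1.
  have /andP[_ ab1] := godel_imp01 a b01.
  rewrite !godel_impP //; last by rewrite ge_min ab1.
  set m := Num.min _ a.
  have ma : m <= a by rewrite ge_min lexx orbT.
  have mab : m <= godel_imp a b by rewrite !ge_min lexx.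
  have mbc : m <= godel_imp b c by rewrite !ge_min lexx orbT.
  exact: godel_imp_mp mbc (godel_imp_mp mab ma).
- by move=> _ _; apply: godel_imp1; rewrite ge_min lexx.
- by move=> _ _; apply: godel_imp1; rewrite minC.
- move=> /andP[_ c1] /andP[_ b1] /andP[_ a1].
  suff -> : godel_imp a (godel_imp b c) = godel_imp (Num.min a b) c.
    by rewrite godel_imp1 // minxx.
  rewrite {2}/godel_imp; case: (leP b c) => bc.
    by rewrite !godel_imp1 // ge_min bc orbT.
  case: (leP a b) => // ba.
  by rewrite !godel_impE // (lt_trans bc).
- by move=> _; apply: godel_imp1; rewrite minxx.
- move=> /andP[_ c1] /andP[_ b1] /andP[_ a1]; apply: godel_imp1.
  have [ab|/ltW ba] := leP a b.
    rewrite (godel_imp1 ab) godel_1imp // godel_impP // ge_min lexx //.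
  rewrite (godel_imp1 ba) godel_1imp // (@godel_imp1 c c) //.
  by rewrite /godel_imp; case: ifP.
- by move=> /andP[a0 _]; apply: godel_imp1.
Qed.

Lemma box_axiom_sound A x : box_axiom A -> value A x = 1.
Proof.
case=> {A} [A B|A]; apply: godel_imp1.
- have /andP[_ A1] := value01 (□ A)%gml x.
  have /andP[_ AB1] := value01 (□ (A → B))%gml x.
  change (value (□ (A → B))%gml x <=
    godel_imp (value (□ A)%gml x) (value (□ B)%gml x)).
  rewrite godel_impP //; apply: box_value_ge => y.
  rewrite godel_impP; last by rewrite ge_min AB1.
  have := box_value_le (A → B)%gml x y; have := box_value_le A x y.
  move: (value (□ A)%gml x) (value (□ (A → B))%gml x) => a ab aA abAB.
  set m := Num.min _ (acc x y).
  have ms : m <= acc x y by rewrite ge_min lexx orbT.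
  have ma : m <= a by rewrite !ge_min lexx orbT.
  have mab : m <= ab by rewrite !ge_min lexx.
  have mA := godel_imp_mp (le_trans ma aA) ms.
  have mAB := godel_imp_mp (le_trans mab abAB) ms.
  exact: godel_imp_mp mAB mA.
- change (godel_imp (godel_imp (value (□ A)%gml x) 0) 0 <=
    value (□ ¬ ¬ A)%gml x).
  apply: box_value_ge => y.
  change (godel_imp (godel_imp (value (□ A)%gml x) 0) 0 <=
    godel_imp (acc x y) (godel_imp (godel_imp (value A y) 0) 0)).
  have := box_value_le A x y; have := value01 (□ A)%gml x.
  have /andP[p0 _] := value01 A y; have := acc01 x y.
  move: (value (□ A)%gml x) (acc x y) (value A y) p0 => a s p p0 _ _ a_sp.
  have zero01 : 0 <= (0 : R) <= 1 by rewrite lexx ler01.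
  have /andP[_ nna1] := godel_imp01 (godel_imp a 0) zero01.
  (* Double negation sends 0 to 0 and positive values to 1. The critical case is [p = 0]: there
     [a > 0] forces [s = 0], since otherwise [a] is at most [s ⇒ 0 = 0]. *)
  have [p_gt0|p_le0] := ltP 0 p.
    rewrite (godel_impE p_gt0) (godel_imp1 (lexx 0)) (le_trans nna1) //.
    by rewrite godel_impP // ge_min lexx.
  rewrite (godel_imp1 p_le0) (godel_impE ltr01).
  have [a_gt0|a_le0] := ltP 0 a; last first.
    rewrite (godel_imp1 a_le0) (godel_impE ltr01).
    by case/andP: (godel_imp01 s zero01).
  rewrite (@godel_imp1 s) // leNgt; apply/negP => s_gt0.
  have p_lt_s := le_lt_trans p_le0 s_gt0.
  by move: a_sp; rewrite (godel_impE p_lt_s) leNgt (le_lt_trans p_le0).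
Qed.

End Model.

Lemma inf01_le (E : set R) a : (forall b, E b -> 0 <= b) -> E a -> inf01 E <= a.
Proof.
by move=> E0 Ea; apply: ge_inf; [exists 0 => b [/E0|->]|left].
Qed.

Lemma inf01_eq1 (E : set R) : (forall b, E b -> b = 1) -> inf01 E = 1.
Proof.
move=> E1; rewrite /inf01 (_ : _ `|` _ = [set 1]) ?inf1 //.
by apply/seteqP; split=> [b [/E1|]|b ->] //; right.
Qed.

Lemma inf01_le1 (E : set R) : (forall b, E b -> 0 <= b) -> inf01 E <= 1.
Proof.
by move=> E0; apply: ge_inf; [exists 0 => b [/E0|->]|right].
Qed.

Lemma soundness (Var : Type) (T : set (formula Var)) A :
  derives T A -> GK_le_consequence R T A.
Proof.
elim=> [{}T {}A TA|{}T {}A ax|{}T {}A ax|{}T {}A B _ IH1 _ IH2|{}T {}A _ IH] M x;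
  have T0 b : [set value B x | B in T] b -> 0 <= b
    by case=> C _ <-; case/andP: (value01 C x).
- by apply: inf01_le => //; exists A.
- by rewrite godel_axiom_sound //; exact: inf01_le1.
- by rewrite box_axiom_sound //; exact: inf01_le1.
- move: (IH1 M x) (IH2 M x) => /=; rewrite godel_impP; last exact: inf01_le1.
  by move=> + xA; rewrite (min_idPl xA).
(* The premise is a theorem and the infimum over no assumptions is 1, so [A] has value 1 at every
   [y]. *)
- apply: box_value_ge => y; rewrite godel_impP; last exact: inf01_le1.
  have := IH M y; rewrite inf01_eq1 => [A1|b [C []]].
  by rewrite ge_min (le_trans (inf01_le1 T0)).
Qed.

End Soundness.

(** * Embedding a countable linear preorder with endpoints into [0,1] *)

Section ChainEmbedding.
Variables (R : realType) (T : Type) (code : T -> nat) (le : T -> T -> Prop).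
Variables bot top : T.
Hypothesis code_inj : injective code.
Hypothesis le_refl : forall x, le x x.
Hypothesis le_trans' : forall x y z, le x y -> le y z -> le x z.
Hypothesis le_total : forall x y, le x y \/ le y x.
Hypothesis bot_le : forall x, le bot x.
Hypothesis le_top : forall x, le x top.
Hypothesis top_bot : ~ le top bot.

(** The height of [x] is the sum of [2^-(code z + 1)] over the [z] below [x], taken as the supremum
    of its partial sums. Discarding the [z] equivalent to [bot] gives [bot] height 0. *)
Let weight x n : R :=
  2^-1 ^+ n.+1 * `[< exists z, [/\ code z = n, le z x & ~ le z bot] >]%:R.
Let partial x N : R := \sum_(n < N) weight x n.
Let height x : R := sup (range (partial x)).

Let weight_ge0 x n : 0 <= weight x n.
Proof. by rewrite mulr_ge0 // exprn_ge0 // invr_ge0. Qed.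

Let partial_le1 x N : partial x N <= 1.
Proof.
(* The sharper geometric bound is what the induction can carry. *)
suff : partial x N <= 1 - 2^-1 ^+ N.
  by move/le_trans; apply; rewrite lerBlDr lerDl exprn_ge0 // invr_ge0.
rewrite /partial; elim: N => [|N IH]; first by rewrite big_ord0 expr0 subrr.
rewrite big_ord_recr /=.
have : weight x N <= 2^-1 ^+ N.+1.
  by rewrite ler_piMr ?exprn_ge0 ?invr_ge0 // lern1 leq_b1.
by rewrite !exprS; lra.
Qed.

Let partial_mono x N K : (N <= K)%N -> partial x N <= partial x K.
Proof.
move=> /subnK <-; elim: (K - N)%N => [|k IH] //.
by rewrite addSn /partial big_ord_recr /= -[leLHS]addr0 lerD.
Qed.

Let partial_height x N : partial x N <= height x.
Proof.
by apply: ub_le_sup; [exists 1 => _ [n _ <-]; exact: partial_le1|exists N].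
Qed.

Let weight_le x y n : le x y -> weight x n <= weight y n.
Proof.
move=> xy; rewrite ler_wpM2l ?exprn_ge0 ?invr_ge0 // ler_nat.
case: asboolP => // -[z [zn zx zb]]; case: asboolP => // -[].
by exists z; split=> //; exact: le_trans' xy.
Qed.

Let height_le x y : le x y -> height x <= height y.
Proof.
move=> xy; apply: ge_sup => [|_ [N _ <-]]; first by exists (partial x 0), 0%N.
apply: le_trans (partial_height y N).
by apply: ler_sum => i _; exact: weight_le.
Qed.

Let height_lt x y : ~ le y x -> height x < height y.
Proof.
move=> yx; have xy : le x y by case: (le_total x y).
(* By injectivity only [y] has the code [code y], so this term is missing for [x] and present for
   [y]; all other terms are monotone. *)
have wx : weight x (code y) = 0.
  rewrite /weight; case: asboolP => [[z [/code_inj -> //]]|_].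
  by rewrite mulr0.
have wy : weight y (code y) = 2^-1 ^+ (code y).+1.
  rewrite /weight; case: asboolP => [_|[]]; first by rewrite mulr1.
  exists y; split=> // yb; apply: yx; exact: le_trans' (bot_le x).
suff : height x + 2^-1 ^+ (code y).+1 <= height y.
  by apply: lt_le_trans; rewrite ltrDl exprn_gt0 // invr_gt0.
rewrite -lerBrDr; apply: ge_sup => [|_ [N _ <-]].
  by exists (partial x 0), 0%N.
(* [K] is large enough for the partial sum to contain the term of index [code y]. *)
rewrite lerBrDr; set K := maxn N (code y).+1.
apply: le_trans (partial_height y K).
apply: (@le_trans _ _ (partial x K + 2^-1 ^+ (code y).+1)).
  by rewrite lerD2r partial_mono // leq_maxl.
have yK : (code y < K)%N by exact: leq_maxr.
rewrite /partial (bigD1 (Ordinal yK)) //= wx add0r.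
rewrite [leRHS](bigD1 (Ordinal yK)) //= wy [leLHS]addrC lerD2l.
by apply: ler_sum => i _; exact: weight_le.
Qed.

Let height_bot : height bot = 0.
Proof.
have p0 N : partial bot N = 0.
  rewrite /partial big1 // => i _; rewrite /weight.
  by case: asboolP => [[z []]|_] //; rewrite mulr0.
by rewrite /height (_ : range _ = [set 0]) ?sup1 //; apply/seteqP; split=>
  [_ [N _ <-]|_ ->] /=; [|exists 0%N].
Qed.

Lemma chain_embedding : exists u : T -> R,
  [/\ forall x, 0 <= u x <= 1, u bot = 0, u top = 1 &
      forall x y, (u x <= u y) <-> le x y].
Proof.
have top0 : 0 < height top by rewrite -height_bot height_lt.
(* Normalising by the positive height of [top] sends [top] to 1. *)
exists (fun x => height x / height top); split.
- move=> x; rewrite divr_ge0 ?(ltW top0) -?height_bot ?height_le //=.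
  by rewrite ler_pdivrMr // mul1r height_le.
- by rewrite height_bot mul0r.
- by rewrite divff // gt_eqF.
- move=> x y; rewrite ler_pM2r ?invr_gt0 //; split=> [|/height_le//].
  by apply: contraPP => /height_lt; rewrite real_ltNge ?num_real // => /negP.
Qed.

End ChainEmbedding.

(** * Gödel valuations and the crisp canonical model *)

Section Canonical.
Variables (R : realType) (Var : Type).
Implicit Types (A B C : formula Var) (v w u : formula Var -> R).

(** There is no clause for [□]: laws relating boxed formulas enter only through [validates]. *)
Definition godel_valuation v :=
  [/\ forall A, 0 <= v A <= 1, v FBot = 0,
      forall A B, v (A ∧ B)%gml = Num.min (v A) (v B) &
      forall A B, v (A → B)%gml = godel_imp (v A) (v B)].

Definition validates (T : set (formula Var)) v :=
  forall A, derives T A -> v A = 1.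

(** The order alone determines the connectives: conjunction is the meet, and implication in a chain
    is forced by residuation. *)
Lemma chain_valuation (T : set (formula Var)) u :
  (forall A, 0 <= u A <= 1) -> u FBot = 0 -> u (FBot → FBot)%gml = 1 ->
  (forall A B, u A <= u B <-> derives T (A → B)%gml) ->
  godel_valuation u /\ validates T u.
Proof.
move=> u01 ubot utop uP.
have uT : validates T u.
  move=> A TA; have /andP[_ uA1] := u01 A; apply/eqP.
  rewrite eq_le uA1 -utop; apply/uP.
  by apply: Der_mp TA; exact: derives_weaken.
split=> //; split=> // A B.
  apply/eqP; rewrite eq_le le_min; apply/andP; split.
    apply/andP; split; apply/uP; [exact: derives_andl|exact: derives_andr].
  rewrite ge_min; have [AB|/ltW BA] := leP (u A) (u B).
    apply/orP; left; apply/uP; apply: derives_pair; first exact: derives_refl.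
    exact/uP.
  apply/orP; right; apply/uP; apply: derives_pair; last exact: derives_refl.
  exact/uP.
have [AB|BA] := leP (u A) (u B).
  by rewrite godel_imp1 //; apply: uT; apply/uP.
have nAB : ~ derives T (A → B)%gml by move/uP; rewrite leNgt BA.
rewrite godel_impE //; apply/eqP; rewrite eq_le; apply/andP; split; apply/uP;
  last exact: derives_weaken.
apply: derives_app (derives_refl _ _) _; apply/uP.
(* If [A → B] lay strictly above [A], then [A → (A → B)] would be derivable, and contraction would
   give [A → B]. *)
rewrite leNgt; apply/negP => /ltW /uP AAB.
by apply: nAB; apply: derives_app AAB (derives_refl _ _).
Qed.

Section Countable.
Variable code : formula Var -> nat.
Hypothesis code_inj : injective code.

Lemma godel_completeness (T : set (formula Var)) A : ~ derives T A ->
  exists u, [/\ godel_valuation u, validates T u & u A < 1].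
Proof.
move=> /linear_extension[U [TU UA linU]].
(* The chain is derivable implication in [U]. Its endpoints differ, because deriving [FBot] would
   derive [A]. *)
have [u [u01 ubot utop uP]] := @chain_embedding R _ code
  (fun B C => derives U (B → C)%gml) FBot (FBot → FBot)%gml code_inj
  (derives_refl U) (@derives_trans _ U) linU
  (fun B => Der_godel U (GAx_exfalso B))
  (fun B => Der_mp (derives_weaken _ _ _) (derives_refl _ _))
  (fun D => UA (Der_mp (Der_godel _ (GAx_exfalso A))
     (Der_mp D (derives_refl _ _)))).
have [uG uU] := chain_valuation u01 ubot utop uP.
exists u; split=> // [B TB|]; first by apply: uU; apply: derives_mono TB.
rewrite ltNge; apply/negP; rewrite -utop => /uP D; apply: UA.
exact: Der_mp D (derives_refl _ _).
Qed.

Definition accessible v w := forall B, v (□ B)%gml <= w B.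

(** The slack [e] is there because the infimum defining the value of [□ A] need not be attained. *)
Lemma accessible_witness v A (e : R) :
  godel_valuation v -> validates set0 v -> v (□ A)%gml < 1 -> 0 < e ->
  exists w, [/\ godel_valuation w, validates set0 w, accessible v w &
    w A <= v (□ A)%gml + e].
Proof.
move=> [v01 vbot vand vimp] vthm; set a := v _ => a1 e0.
have /andP[a0 _] : 0 <= a <= 1 by exact: v01.
have vK B C : v (□ (B → C))%gml <= godel_imp (v (□ B)%gml) (v (□ C)%gml).
  have := vthm _ (Der_box _ (BAx_K B C)); rewrite !vimp.
  by apply: godel_imp_eq1; case/andP: (v01 (□ (B → C))%gml).
have [u [[u01 ubot uand uimp] uthm uA]] : exists u, [/\ godel_valuation u,
    validates [set B | a < v (□ B)%gml] u & u A < 1].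
  apply: godel_completeness => D.
  suff : a < v (□ A)%gml by rewrite ltxx.
  (* The formulas whose box exceeds [a] contain all theorems and, by K, are closed under Modus
     Ponens; hence everything derived from them is again among them. *)
  move TE : [set B | _] D => T D.
  have thm B : derives set0 B -> a < v (□ B)%gml.
    by move=> thmB; rewrite vthm //; exact: Der_nec.
  elim: D TE => [{}T B TB|{}T B ax|{}T B ax|{}T B C _ IH1 _ IH2|{}T B D _] TE.
  - by rewrite -TE in TB.
  - exact/thm/Der_godel.
  - exact/thm/Der_box.
  - have aBC := IH1 TE; have aB := IH2 TE.
    set m := Num.min (v (□ (B → C))%gml) (v (□ B)%gml).
    have am : a < m by rewrite lt_min aBC.
    apply: lt_le_trans am _; apply: (@godel_imp_mp _ (v (□ B)%gml)).
      by apply: le_trans (vK B C); rewrite ge_min lexx.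
    by rewrite ge_min lexx orbT.
  - exact/thm/Der_nec.
(* Positivity of [v (□ B)] makes [v (¬ ¬ □ B)] equal to 1; by Z also [v (□ ¬ ¬ B) = 1 > a], so
   [u (¬ ¬ B) = 1]. *)
have u_gt0 B : 0 < v (□ B)%gml -> 0 < u B.
  move=> vB.
  have : u (¬ ¬ B)%gml = 1.
    apply/uthm/Der_assum => /=; apply: lt_le_trans a1 _.
    have := vthm _ (Der_box _ (BAx_Z B)); rewrite !vimp vbot.
    rewrite (godel_impE vB) (godel_imp1 (lexx 0)).
    by apply: godel_imp_eq1.
  rewrite !uimp ubot; case: (ltP 0 (u B)) => // uB.
  by rewrite (godel_imp1 uB) (godel_impE ltr01) => /esym/eqP; rewrite oner_eq0.
pose d := Num.min e (1 - a).
have d0 : 0 < d by rewrite lt_min e0 subr_gt0.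
have ad1 : a + d <= 1 by rewrite -lerBrDl ge_min lexx orbT.
(* On [0,1], [g] is strictly increasing and fixes 0 and 1, so [g \o u] is again a Gödel valuation.
   The choice of [d] keeps the values inside (0,1) below both [a + e] and 1. *)
pose g t : R := if t <= 0 then 0 else if 1 <= t then 1 else a + d * t.
have g_lt s t : 0 <= s -> s < t -> t <= 1 -> g s < g t.
  move=> s0 st t1; rewrite /g [t <= 0]leNgt (le_lt_trans s0 st) /=.
  rewrite [1 <= s]leNgt (lt_le_trans st t1) /=.
  have t0 := le_lt_trans s0 st.
  have adt : 0 < a + d * t by rewrite ltr_wpDl // mulr_gt0.
  case: (leP s 0) => s0'; first by case: ifP.
  case: ifP => _; last by rewrite ltrD2l ltr_pM2l.
  apply: lt_le_trans ad1; rewrite ltrD2l gtr_pMr //.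
  exact: lt_le_trans st t1.
have g_le s t : 0 <= s <= 1 -> 0 <= t <= 1 -> (g s <= g t) = (s <= t).
  move=> /andP[s0 s1] /andP[t0 t1]; have [st|ts|->] := ltgtP s t.
  - by rewrite ltW // g_lt.
  - by apply/negbTE; rewrite -ltNge g_lt.
  - by rewrite lexx.
have g0 : g 0 = 0 by rewrite /g lexx.
have g1 : g 1 = 1 by rewrite /g lexx leNgt ltr01.
have zero01 : 0 <= (0 : R) <= 1 by rewrite lexx ler01.
have one01 : 0 <= (1 : R) <= 1 by rewrite lexx ler01.
have gu01 B : 0 <= g (u B) <= 1.
  have /andP[uB0 uB1] := u01 B.
  by rewrite -[X in X <= _]g0 -[X in _ && (_ <= X)]g1 !g_le // uB0.
exists (g \o u); split.
- split=> //= [|B C|B C]; first by rewrite ubot.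
  + rewrite uand; have [BC|CB] := leP (u B) (u C).
      by rewrite (min_idPl _) // g_le.
    by rewrite (min_idPr _) // g_le // ltW.
  + by rewrite uimp /godel_imp g_le //; case: ifP.
- by move=> B thmB /=; rewrite uthm //; exact: derives_thm.
(* Either [a < v (□ B)] and [w B = 1], or [v (□ B) = 0], or [0 < v (□ B) <= a] and [u B > 0] gives
   [w B >= a]. *)
- move=> B /=; have [aB|Ba] := ltP a (v (□ B)%gml).
    rewrite (uthm B) ?g1; last exact: Der_assum.
    by case/andP: (v01 (□ B)%gml).
  have [vB|vB] := leP (v (□ B)%gml) 0.
    by apply: le_trans vB _; case/andP: (gu01 B).
  have uB := u_gt0 _ vB; rewrite /g [u B <= 0]leNgt uB /=.
  case: ifP => _; first by case/andP: (v01 (□ B)%gml).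
  by apply: le_trans Ba _; rewrite lerDl mulr_ge0 // ltW.
- rewrite /= /g; case: ifP => _; first by rewrite addr_ge0 // ltW.
  rewrite [1 <= u A]leNgt uA /= lerD2l.
  have /andP[_ uA1] := u01 A.
  apply: (@le_trans _ _ d); last by rewrite ge_min lexx.
  by rewrite ger_pMr.
Qed.

Section CanonicalModel.
Variable v0 : formula Var -> R.
Hypotheses (v0G : godel_valuation v0) (v0thm : validates set0 v0).

Definition canonical_world := {v | godel_valuation v /\ validates set0 v}.

Definition canonical_acc (x y : canonical_world) : R :=
  `[< accessible (sval x) (sval y) >]%:R.

Lemma canonical_acc01 x y : 0 <= canonical_acc x y <= 1.
Proof. by rewrite ler0n lern1 leq_b1. Qed.

Lemma canonical_atom01 (x : canonical_world) p : 0 <= sval x (FVar p) <= 1.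
Proof. by case: x => v [[]]. Qed.

Definition canonical_model : GKmodel R Var :=
  @MkGKmodel R Var canonical_world
    (inhabits (exist _ v0 (conj v0G v0thm)))
    canonical_acc canonical_acc01
    (fun x p => sval x (FVar p)) canonical_atom01.

Lemma canonical_crisp : crisp canonical_model.
Proof.
by move=> x y; rewrite /= /canonical_acc; case: asboolP; [right|left].
Qed.

(** Truth lemma. In the box case, one inequality uses successors approximating [v (□ B)] within
    every [e], the other is the definition of [accessible]. *)
Lemma canonical_value A (x : world canonical_model) : value A x = sval x A.
Proof.
elim: A x => [p||B IHB C IHC|B IHB C IHC|B IHB] x.
- by [].
- by have [[_ -> _ _] _] := proj2_sig x.
- by rewrite /= IHB IHC; have [[_ _ vand _] _] := proj2_sig x; rewrite vand.
- by rewrite /= IHB IHC; have [[_ _ _ vimp] _] := proj2_sig x; rewrite vimp.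
apply/eqP; rewrite eq_le; apply/andP; split.
  case: x => v vP; have [vG vthm] := vP; rewrite [leRHS]/=.
  have [v1|v1] := leP 1 (v (□ B)%gml).
    pose x : world canonical_model := exist _ v vP.
    by apply: le_trans v1; case/andP: (value01 (□ B)%gml x).
  apply/ler_addgt0Pr => e /(accessible_witness vG vthm v1)[w [wG wthm vw wB]].
  pose y : world canonical_model := exist _ w (conj wG wthm).
  apply: le_trans (box_value_le B _ y) _; rewrite IHB /= /canonical_acc /=.
  rewrite asboolT // godel_1imp //; by have [/(_ B)/andP[]] := wG.
apply: box_value_ge => y; rewrite IHB /= /canonical_acc.
have [[v01 _ _ _] _] := proj2_sig x; have [[w01 _ _ _] _] := proj2_sig y.
have /andP[_ vB1] := v01 (□ B)%gml; have /andP[w0 wB1] := w01 B.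
by case: asboolP => [vw|_]; [rewrite godel_1imp|rewrite godel_imp1].
Qed.

End CanonicalModel.

Lemma crisp_completeness (T : set (formula Var)) A :
  crisp_consequence R T A -> derives T A.
Proof.
move=> TA; apply: contrapT => /godel_completeness[v [vG vT vA]].
have vthm : validates set0 v by move=> B thmB; apply: vT; exact: derives_thm.
pose x : world (canonical_model vG vthm) := exist _ v (conj vG vthm).
suff : value A x = 1 by rewrite canonical_value => xA; move: vA; rewrite -xA ltxx.
apply: TA => [|B TB]; first exact: canonical_crisp.
by rewrite canonical_value; apply: vT; exact: Der_assum.
Qed.

End Countable.
End Canonical.

(** * Coding formulas over natural number variables *)

Fixpoint formula_tree (A : formula nat) : GenTree.tree nat :=
  match A with
  | FVar p => GenTree.Leaf p
  | FBot => GenTree.Node 0 [::]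
  | FAnd B C => GenTree.Node 1 [:: formula_tree B; formula_tree C]
  | FImp B C => GenTree.Node 2 [:: formula_tree B; formula_tree C]
  | FBox B => GenTree.Node 3 [:: formula_tree B]
  end.

Lemma formula_tree_inj : injective formula_tree.
Proof.
by elim=> [p||B IHB C IHC|B IHB C IHC|B IHB] [q||D E|D E|D] //= [] =>
  [->|/IHB-> /IHC->|/IHB-> /IHC->|/IHB->].
Qed.

Lemma crisp_completeness_nat (R : realType) (T : set (formula nat)) A :
  crisp_consequence R T A -> derives T A.
Proof.
apply: (@crisp_completeness _ _ (pickle \o formula_tree)).
exact: inj_comp (pcan_inj pickleK) formula_tree_inj.
Qed.

(** * Reduction to natural number variables *)

Section Renaming.
Variables (R : realType) (Var : Type).
Implicit Types (A B : formula Var) (T : set (formula Var)).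

Fixpoint variables A : seq Var :=
  match A with
  | FVar p => [:: p]
  | FBot => [::]
  | FAnd B C | FImp B C => variables B ++ variables C
  | FBox B => variables B
  end.

(** Occurrences are given by position because [Var] is a bare type; positions also serve later to
    number the variables. *)
Lemma subst_comp_id (f : Var -> nat) (s : nat -> formula Var) A :
  (forall i p, onth (variables A) i = Some p -> s (f p) = FVar p) ->
  subst s (subst (fun p => FVar (f p)) A) = A.
Proof.
elim: A => [p|//|B IHB C IHC|B IHB C IHC|B IHB] /= sP; first exact: (sP 0%N).
1,2: rewrite IHB ?IHC // => i p ip; [apply: (sP (size (variables B) + i)%N)|
  apply: (sP i)].
all: try by rewrite onth_cat ltnNge leq_addr /= addKn.
1,2: rewrite onth_cat; case: ltnP => // Bi.
1,2: by rewrite onth_default in ip.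
by rewrite IHB.
Qed.

Definition rename_model (f : Var -> nat) (M : GKmodel R nat) : GKmodel R Var :=
  @MkGKmodel R Var (world M) (world_inhabited M) (@acc _ _ M) (@acc01 _ _ M)
    (fun x p => atom_val x (f p)) (fun x p => atom_val01 x (f p)).

Lemma rename_model_value f M A (x : world M) :
  value A (x : world (rename_model f M)) = value (subst (fun p => FVar (f p)) A) x.
Proof.
elim: A x => [p||B IHB C IHC|B IHB C IHC|B IHB] x //=; rewrite ?IHB ?IHC //.
by congr inf; apply: eq_imagel => y _; rewrite IHB.
Qed.

(** [Var] may be uncountable, but a variable occurring in [T] is determined by the code of a formula
    and a position in it. [f] picks one such pair and [s] decodes it; the defaults 0 and [FBot]
    concern only variables and numbers without occurrence. *)
Lemma countable_variables T : countable T ->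
  exists (f : Var -> nat) (s : nat -> formula Var),
    forall A, T A -> subst s (subst (fun p => FVar (f p)) A) = A.
Proof.
move=> /countable_injP[c c_inj].
pose occurs n p :=
  exists A i, [/\ T A, n = pickle (c A, i) & onth (variables A) i = Some p].
have occurs_inj n p q : occurs n p -> occurs n q -> p = q.
  move=> [A [i [TA -> Ap]]] [B [j [TB + Bq]]].
  move=> /(pcan_inj pickleK)[/c_inj AB ij]; rewrite AB ?inE // ij in Ap.
  by move: Ap; rewrite Bq => -[].
have /choice[f fP] p : exists n, (exists m, occurs m p) -> occurs n p.
  have [[n np]|np] := pselect (exists n, occurs n p); first by exists n.
  by exists 0%N => /np.
have /choice[s sP] n : exists B, forall p, occurs n p -> B = FVar p.
  have [[p np]|np] := pselect (exists p, occurs n p).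
    by exists (FVar p) => q /(occurs_inj _ _ _ np) ->.
  by exists FBot => p pn; case: np; exists p.
exists f, s => A TA; apply: subst_comp_id => i p Ap; apply: sP; apply: fP.
by exists (pickle (c A, i)), A, i.
Qed.

End Renaming.

Theorem theorem11 (R : realType) (Var : Type) (T : set (formula Var))
    (phi : formula Var) (T_countable : countable T) :
  [<-> derives T phi;
       GK_le_consequence R T phi;
       GK_consequence R T phi;
       crisp_consequence R T phi].
Proof.
tfae; first exact: soundness.
- move=> le_phi M x Tx; apply/eqP; have /andP[_ phi1] := value01 phi x.
  rewrite eq_le phi1; apply: le_trans (le_phi M x).
  by rewrite inf01_eq1 // => _ [B TB <-]; exact: Tx.
- by move=> phi_GK M _; exact: phi_GK.
move=> phi_crisp.
(* The renaming must be invertible on [phi] as well as on [T]. *)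
have [f [s fsK]] : exists (f : Var -> nat) (s : nat -> formula Var),
    forall A, (phi |` T) A -> subst s (subst (fun p => FVar (f p)) A) = A.
  apply: countable_variables.
  have -> : phi |` T = \bigcup_(b in [set: bool]) if b then [set phi] else T.
    by apply/seteqP; split=> [B [?|?]|B [[] _ ?]];
      [exists true|exists false|left|right].
  by apply: bigcup_countable => // -[] _ //; exact: countable1.
set ren := subst (fun p => FVar (f p)) in fsK.
(* A derivation of the renamed formula is carried back by [s], as derivability is stable under
   substitution. *)
suff D : derives (ren @` T) (ren phi).
  have := derives_subst s D; rewrite fsK; last by left.
  rewrite image_comp (_ : _ @` _ = T) //.
  have idT A : T A -> (subst s \o ren) A = A by move=> TA; apply: fsK; right.
  by apply/seteqP; split=> [_ [A TA <-]|A TA]; [rewrite idT|exists A; rewrite ?idT].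
(* A crisp model for the renamed language pulls back along [f] to a model on the same frame, hence
   again crisp. *)
apply: (@crisp_completeness_nat R) => M M_crisp x Tx.
rewrite -(rename_model_value f phi x); apply: phi_crisp => // B TB.
by rewrite rename_model_value; apply: Tx; exists B.
Qed.
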